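(* Suppose $Y\sim\sum_{k=1}^K\pi_kN(\mu_k,\sigma_k^2)$, with $\sum_{k=1}^K\pi_k=1$, where $K$, the mixing proportions $\pi_k$, and the component parameters $\mu_k\in\mathbb{R}$, $\sigma_k^2>0$ are all unknown, and suppose $P(R=1\mid Y=y)=F(\alpha+\beta y)$ with unknown $\alpha,\beta\in\mathbb{R}$ and a known strictly monotone distribution function $F$ with support on $(-\infty,+\infty)$. Suppose that $F$ satisfies both of the following conditions: (A) for every $\delta>0$, $\lim_{z\to-\infty}F(z)/e^{\delta z}$ equals $0$ or $+\infty$; (B) for every $\theta_0\in(-\infty,+\infty)$, $\theta_1>0$, and $\delta_1,\delta_2\ge0$ with $\delta_1+\delta_2\neq0$, the limit $\lim_{z\to+\infty}\{F(\theta_0+\theta_1z)-F(z)\}/e^{-\delta_1z^2-\delta_2z}$ equals $0$ or $\infty$ (infinity being understood in absolute value, as the quotient may be negative). Then all the parameters $K$, $\{(\pi_k,\mu_k,\sigma_k^2):k=1,\ldots,K\}$, $\alpha$ and $\beta$ are identifiable.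
   Context: $Y$ is an outcome variable and $R\in\{0,1\}$ is its missingness indicator ($R=1$ if $Y$ is observed). The observed distribution is $P(y,R=1)$, which here is the function $y\mapsto\sum_{k=1}^K\frac{\pi_k}{\sigma_k}\phi\left(\frac{y-\mu_k}{\sigma_k}\right)F(\alpha+\beta y)$, where $\phi$ is the standard normal density. Mixtures are written with $\pi_k>0$ and distinct pairs $(\mu_k,\sigma_k^2)$. The parameters are identifiable if any two parameter sets yielding the same observed distribution have the same $K$, the same set $\{(\pi_k,\mu_k,\sigma_k^2)\}$ (i.e. equality up to relabelling of components), and the same $\alpha,\beta$. *)

(* Defs.v *)
From HB Require Import structures.
From mathcomp Require Import all_boot all_order all_algebra.
From mathcomp Require Import all_classical all_reals all_analysis.

Set Implicit Arguments.
Unset Strict Implicit.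
Unset Printing Implicit Defensive.

Import Order.TTheory GRing.Theory Num.Theory.
Import numFieldNormedType.Exports.

Local Open Scope classical_set_scope.
Local Open Scope ring_scope.

(* Parameters of the model  Y ~ \sum_k prop k * N(mean k, var k),
   P(R = 1 | Y = y) = F (intercept + slope * y).  [var] is sigma_k^2. *)
Record params (R : realType) := Params {
  ncomp : nat;
  prop : 'I_ncomp -> R;
  mean : 'I_ncomp -> R;
  var : 'I_ncomp -> R;
  intercept : R;
  slope : R
}.

Definition sd (R : realType) (t : params R) (k : 'I_(ncomp t)) : R :=
  Num.sqrt (var k).

(* Nothing is required of [intercept] and [slope]; slope = 0 is allowed. *)
Definition admissible (R : realType) (t : params R) : Prop :=
  [/\ forall k : 'I_(ncomp t), 0 < prop k,
      forall k : 'I_(ncomp t), 0 < var k,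
      \sum_(k < ncomp t) prop k = 1
    & injective (fun k : 'I_(ncomp t) => (mean k, var k))].

(* y |-> P(y, R = 1); [normal_pdf 0 1] is the standard normal density. *)
Definition observed (R : realType) (F : R -> R) (t : params R) (y : R) : R :=
  \sum_(k < ncomp t)
    prop k / sd k * normal_pdf 0 1 ((y - mean k) / sd k)
    * F (intercept t + slope t * y).

Definition components (R : realType) (t : params R) : set (R * R * R) :=
  range (fun k : 'I_(ncomp t) => (prop k, mean k, var k)).

(* The (mean, var) pairs of an admissible parameter are distinct, so equality
   of the component sets is equality up to a relabelling of the components. *)
Definition same_params (R : realType) (s t : params R) : Prop :=
  [/\ ncomp s = ncomp t, components s = components t,
      intercept s = intercept t & slope s = slope t].

Definition identifiable (R : realType) (F : R -> R) : Prop :=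
  forall s t : params R, admissible s -> admissible t ->
    observed F s =1 observed F t -> same_params s t.

(* Topological support of the law with distribution function F. *)
Definition cdf_support (R : realType) (F : cumulativeBounded (0 : R) (1 : R)) :
    set R :=
  [set x | forall U : set R, open_nbhs x U ->
             (0 < lebesgue_stieltjes_measure F U)%E].

Definition left_tail_condition (R : realType) (F : R -> R) : Prop :=
  forall delta : R, 0 < delta ->
    let q z := F z / expR (delta * z) in
    q z @[z --> -oo] --> 0 \/ q z @[z --> -oo] --> +oo.

(* The quotient may be negative: an infinite limit is one in absolute value. *)
Definition right_tail_condition (R : realType) (F : R -> R) : Prop :=
  forall theta0 theta1 delta1 delta2 : R,
    0 < theta1 -> 0 <= delta1 -> 0 <= delta2 -> delta1 + delta2 != 0 ->
    let q z := (F (theta0 + theta1 * z) - F z)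
               / expR (- delta1 * z ^+ 2 - delta2 * z) in
    q z @[z --> +oo] --> 0 \/ `|q z| @[z --> +oo] --> +oo.

(* Main.v *)
(* Both mixture densities are finite combinations of functions
   exp (p y^2 + q y), which are ordered at +oo lexicographically by (p, q).
   Reflection y -> - y turns the study at -oo into the study at +oo.

   If the slopes have opposite signs, comparing leading terms at both ends shows
   that the largest variances agree, so that F (z) / exp (delta z) has a
   positive finite limit at -oo, which (A) excludes.  If both slopes are zero,
   linear independence of Gaussians concludes.

   If both slopes are positive and the densities differ, then along an affine
   map T we get F (T z) - F z ~ C exp (- Q z) with Q of degree at most 2.  This
   does not contradict (B) directly, as the linear coefficient of Q may be
   negative.  Summing along the orbit of T shows instead that 1 - F itself is
   comparable to exp (- Q), and then F (z / 2 + theta0) - F z, with theta0 chosen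
   to cancel the linear term if Q is quadratic, contradicts (B). *)
Require Import Defs.
From HB Require Import structures.
From mathcomp Require Import all_boot all_order all_algebra.
From mathcomp Require Import all_classical all_reals all_analysis.
From mathcomp Require Import ring lra.
Set Implicit Arguments.
Unset Strict Implicit.
Unset Printing Implicit Defensive.

Import Order.TTheory GRing.Theory Num.Theory.
Import numFieldNormedType.Exports.

Local Open Scope classical_set_scope.
Local Open Scope ring_scope.

(** * Quadratic exponentials, their lexicographic order, and leading terms at +oo *)

Definition gexp (R : realType) (x : R * R) (y : R) : R :=
  expR (x.1 * y ^+ 2 + x.2 * y).

Definition lexlt (R : realType) (x y : R * R) : bool :=
  (x.1 < y.1) || ((x.1 == y.1) && (x.2 < y.2)).

Section Asymptotics.
Variable R : realType.
Implicit Types (x y z : R * R) (t u p q r : R).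

Lemma lexlt_total x y : x != y -> lexlt x y || lexlt y x.
Proof.
case: x y => [p q] [p' q']; rewrite /lexlt /= xpair_eqE.
by case: (ltrgtP p p') => //= _; case: (ltrgtP q q').
Qed.

Lemma lexlt_trans x y z : lexlt x y -> lexlt y z -> lexlt x z.
Proof.
rewrite /lexlt => /orP[xy|/andP[/eqP-> xy]] /orP[yz|/andP[/eqP<- yz]].
- by rewrite (lt_trans xy yz).
- by rewrite xy.
- by rewrite yz.
- by rewrite eqxx (lt_trans xy yz) orbT.
Qed.

Lemma lexlt_sub x y : lexlt x y = lexlt (x - y) 0.
Proof. by rewrite /lexlt /= !subr_lt0 subr_eq0. Qed.

Lemma gexp_gt0 x t : 0 < gexp x t. Proof. exact: expR_gt0. Qed.

Lemma gexpB x y t : gexp (x - y) t = gexp x t / gexp y t.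
Proof. by rewrite /gexp -expRN -expRD; congr expR => /=; ring. Qed.

Lemma affine_cvgy p q : 0 < q -> p + q * t @[t --> +oo] --> +oo.
Proof.
move=> q0; apply/cvgryPge => A; near=> t.
rewrite addrC -lerBlDr mulrC -ler_pdivrMr //; near: t.
Unshelve. all: by end_near. Qed.

Lemma affine_cvgNy p q : q < 0 -> p + q * t @[t --> +oo] --> -oo.
Proof.
move=> q0; apply/cvgNry; rewrite [X in X @ _](_ : _ = fun t => - p + (- q) * t).
  by apply: affine_cvgy; rewrite oppr_gt0.
by apply/funext => t /=; rewrite !fctE; ring.
Qed.

Lemma quadratic_cvgy p q r : lexlt (- (p, q)) 0 ->
  p * t ^+ 2 + q * t + r @[t --> +oo] --> +oo.
Proof.
rewrite /lexlt /= oppr_eq0 !oppr_lt0 => /orP[p0|/andP[/eqP-> q0]]; last first.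
  rewrite (_ : (fun _ => _) = fun t => r + q * t); first exact: affine_cvgy.
  by apply/funext => t; ring.
(* For p > 0 the quadratic exceeds r + t once t >= 0 and p t + q >= 1. *)
apply: (@ger_cvgy _ _ _ _ (fun t => r + 1 * t)); last exact: affine_cvgy.
near=> t.
suff : 0 <= (p * t + q - 1) * t by lra.
apply: mulr_ge0; last first.
  by near: t; exact: nbhs_pinfty_ge.
have : (1 - q) / p <= t.
  by near: t; apply: nbhs_pinfty_ge; rewrite num_real.
by rewrite ler_pdivrMr // => ?; lra.
Unshelve. all: by end_near. Qed.

Lemma gexp_cvg0 x : lexlt x 0 -> gexp x t @[t --> +oo] --> 0.
Proof.
move=> x0.
rewrite (_ : (fun t => _) =
  (fun u => expR (- u)) \o (fun t => (- x).1 * t ^+ 2 + (- x).2 * t + 0)).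
  apply: (cvg_comp _ _ _ (@cvgr_expR R)); apply: quadratic_cvgy.
  by rewrite -surjective_pairing opprK.
by apply/funext => t /=; rewrite /gexp; congr expR; ring.
Qed.

(** Distinct exponents rule out cancellation. By induction, the head of the list competes with the
    leading term of the rest: the lexicographically larger exponent wins, and the quotient of the
    other by it tends to 0. *)
Lemma lead_dichotomy (I : eqType) (L : seq I) (c : I -> R) (e : I -> R * R) :
  uniq (map e L) ->
  (forall i, i \in L -> c i = 0) \/
  exists2 i, i \in L &
    [/\ c i != 0,
        forall j, j \in L -> c j != 0 -> (j == i) || lexlt (e j) (e i) &
        (\sum_(j <- L) c j * gexp (e j) t) / gexp (e i) t @[t --> +oo] --> c i].
Proof.
elim: L => [|i L IH] /=; first by left.
case/andP=> iL /IH{IH} IH.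
have self (k : I) :
    c k * gexp (e k) t / gexp (e k) t @[t --> +oo] --> c k.
  rewrite (_ : (fun _ => _) = fun=> c k); first exact: cvg_cst.
  by apply/funext => t; rewrite mulfK // gt_eqF // gexp_gt0.
have other (k j : I) : lexlt (e j) (e k) ->
    c j * gexp (e j) t / gexp (e k) t @[t --> +oo] --> 0.
  rewrite lexlt_sub => /gexp_cvg0 ejk.
  rewrite (_ : (fun _ => _) = fun t => c j * gexp (e j - e k) t).
    by rewrite -(mulr0 (c j)); apply: cvgM => //; exact: cvg_cst.
  by apply/funext => t; rewrite gexpB mulrA.
have [ci0|ci0] := eqVneq (c i) 0.
  case: IH => [c0|[k kL [ck0 kmax klim]]].
    by left=> j; rewrite inE => /predU1P[->|/c0].
  right; exists k; first by rewrite inE kL orbT.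
  split=> // [j|]; first by rewrite inE => /predU1P[->|/kmax//]; rewrite ci0 eqxx.
  rewrite (_ : (fun _ => _) =
    fun t => (\sum_(j <- L) c j * gexp (e j) t) / gexp (e k) t) //.
  by apply/funext => t; rewrite big_cons ci0 mul0r add0r.
right; case: IH => [c0|[k kL [ck0 kmax klim]]].
  exists i; first by rewrite inE eqxx.
  split=> // [j|].
    by rewrite inE => /predU1P[->|/c0->]; rewrite ?eqxx.
  rewrite (_ : (fun _ => _) = fun t => c i * gexp (e i) t / gexp (e i) t) //.
  apply/funext => t; rewrite big_cons [X in _ + X]big1_seq ?addr0 //.
  by move=> j /andP[_ /c0->]; rewrite mul0r.
have ik : e i != e k.
  by apply: contraNneq iL => ->; rewrite map_f.
have /orP[eik|eki] := lexlt_total ik.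
  exists k; first by rewrite inE kL orbT.
  split=> // [j|].
    by rewrite inE => /predU1P[->|/kmax//]; rewrite eik orbT.
  rewrite -(add0r (c k)); under eq_fun do rewrite big_cons mulrDl.
  by apply: cvgD => //; exact: other.
exists i; first by rewrite inE eqxx.
split=> // [j|].
  rewrite inE => /predU1P[->|jL cj0]; first by rewrite eqxx.
  have /orP[/eqP->|/lexlt_trans] := kmax _ jL cj0; first by rewrite eki orbT.
  by move=> /(_ _ eki) ->; rewrite orbT.
rewrite -(addr0 (c i)); under eq_fun do rewrite big_cons mulrDl.
apply: cvgD => //.
rewrite -[X in _ --> X](mulr0 (c k)).
rewrite (_ : (fun _ => _) = fun t =>
    (\sum_(j <- L) c j * gexp (e j) t) / gexp (e k) t * gexp (e k - e i) t).
  by apply: cvgM => //; apply: gexp_cvg0; rewrite -lexlt_sub.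
by apply/funext => t; rewrite gexpB mulrA divfK // gt_eqF // gexp_gt0.
Qed.

End Asymptotics.

(** * Reading the order of exponents off asymptotic relations *)

Section Comparison.
Variable R : realType.
Implicit Types (x y : R * R) (u v : R -> R) (c d t : R).

(** Otherwise [gexp (y - x)] has a finite limit l, namely 1 or 0, and u / gexp x = (u / v) (v / gexp
    y) gexp (y - x) tends to 0 * d * l = 0 instead of c. *)
Lemma lexlt_of_ratio_cvg0 u v x y c d :
  (forall t, 0 < v t) -> c != 0 ->
  u t / gexp x t @[t --> +oo] --> c -> v t / gexp y t @[t --> +oo] --> d ->
  u t / v t @[t --> +oo] --> 0 -> lexlt x y.
Proof.
move=> v0 c0 ux vy uv.
suff nyx (l : R) : ~ (gexp (y - x) t @[t --> +oo] --> l).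
  have [xy|/lexlt_total/orP[//|]] := eqVneq x y; last first.
    by rewrite lexlt_sub => /gexp_cvg0/nyx.
  case: (nyx 1); rewrite (_ : (fun _ => _) = fun=> 1); first exact: cvg_cst.
  by apply/funext => t; rewrite xy gexpB divff // gt_eqF // gexp_gt0.
move=> ll; move: c0; suff -> : c = 0 * d * l by rewrite !mul0r eqxx.
rewrite (_ : (fun t => _) =
  (fun t => u t / v t) \* (fun t => v t / gexp y t) \* gexp (y - x)) in ux.
  exact: (cvg_unique (@norm_hausdorff _ R) ux (cvgM (cvgM uv vy) ll)).
apply/funext => t /=; rewrite gexpB.
have := gexp_gt0 x t; have := gexp_gt0 y t; have := v0 t => ? ? ?.
by field; rewrite !gt_eqF.
Qed.

Lemma nlexlt_of_le u v x y c d :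
  0 < c -> (\forall t \near +oo, u t <= v t) ->
  u t / gexp x t @[t --> +oo] --> c -> v t / gexp y t @[t --> +oo] --> d ->
  ~~ lexlt y x.
Proof.
move=> c0 uv ux vy; apply/negP; rewrite lexlt_sub => /gexp_cvg0 yx.
move: c0; rewrite ltNge => /negP; apply; rewrite -(mulr0 d).
apply: (ler_cvg_to ux (cvgM vy yx)).
near=> t; rewrite /= gexpB.
rewrite (_ : v t / _ * _ = v t / gexp x t).
  by rewrite ler_pM2r ?invr_gt0 ?gexp_gt0 //; near: t.
by field; rewrite !gt_eqF ?gexp_gt0.
Unshelve. all: by end_near. Qed.

End Comparison.

(** * Gaussian mixtures as combinations of quadratic exponentials *)

Definition atom_exp (R : realType) (x : R * R) : R * R :=
  (- (2 * x.2)^-1, x.1 / x.2).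

(** For x = (m, v), the exponent -(y - m)^2 / (2 v) is the polynomial encoded by [atom_exp x] plus
    the constant -m^2 / (2 v), which is absorbed here. *)
Definition atom_coef (R : realType) (x : R * R) : R :=
  normal_peak 1 / Num.sqrt x.2 * expR (- (x.1 ^+ 2 / (2 * x.2))).

Definition moments (R : realType) (t : params R) (k : 'I_(ncomp t)) : R * R :=
  (mean k, var k).

Definition atoms (R : realType) (t : params R) : seq (R * R) :=
  codom (@moments R t).

(** Defined on all pairs and 0 off the atoms, so that mixtures with different numbers of components
    can be compared pointwise. *)
Definition weight (R : realType) (t : params R) (x : R * R) : R :=
  \sum_(k < ncomp t | moments k == x) prop k.

Definition density (R : realType) (t : params R) (y : R) : R :=
  \sum_(k < ncomp t) prop k / sd k * normal_pdf 0 1 ((y - mean k) / sd k).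

Definition mirror (R : realType) (t : params R) : params R :=
  Params (@prop R t) (fun k => - mean k) (@var R t) (intercept t) (- slope t).

Section Mixtures.
Variable R : realType.
Implicit Types (s t : params R) (x : R * R) (y : R) (F : R -> R).

Lemma observedE F t y :
  observed F t y = density t y * F (intercept t + slope t * y).
Proof. by rewrite /observed /density mulr_suml. Qed.

Lemma atom_coef_gt0 x : 0 < x.2 -> 0 < atom_coef x.
Proof.
move=> x0; rewrite mulr_gt0 ?expR_gt0 // divr_gt0 ?sqrtr_gt0 //.
by rewrite normal_peak_gt0 // oner_eq0.
Qed.

Lemma normal_pdf01E (u : R) :
  normal_pdf 0 1 u = normal_peak 1 * expR (- (u ^+ 2 / 2)).
Proof.
by rewrite /normal_pdf oner_eq0 /= /normal_fun subr0 expr1n mulNr.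
Qed.

Lemma normal_pdf_gexp x y : 0 < x.2 ->
  (Num.sqrt x.2)^-1 * normal_pdf 0 1 ((y - x.1) / Num.sqrt x.2) =
  atom_coef x * gexp (atom_exp x) y.
Proof.
move=> x0; have s0 : Num.sqrt x.2 != 0 by rewrite gt_eqF // sqrtr_gt0.
rewrite normal_pdf01E /atom_coef /gexp /= -[RHS]mulrA -expRD.
rewrite mulrA [_^-1 * _]mulrC; congr (_ * expR _).
rewrite expr_div_n sqr_sqrtr ?ltW //; field; exact: lt0r_neq0.
Qed.

Lemma atom_exp_inj (L : seq (R * R)) : (forall x, x \in L -> 0 < x.2) ->
  {in L &, injective (@atom_exp R)}.
Proof.
move=> L0 [m v] [m' v'] /L0/= v0 /L0/= v'0 [].
move=> /oppr_inj/invr_inj/mulfI vv'.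
have {vv'} vv' : v = v' by apply: vv'; rewrite pnatr_eq0.
by rewrite vv' => /divIf ->//; rewrite gt_eqF.
Qed.

Lemma atoms_var_gt0 t x : admissible t -> x \in atoms t -> 0 < x.2.
Proof. by move=> [_ v0 _ _] /codomP[k ->]; exact: v0. Qed.

Lemma atoms_uniq t : admissible t -> uniq (atoms t).
Proof. by move=> [_ _ _ inj]; exact/injectiveP. Qed.

Lemma mem_atoms t k : @moments R t k \in atoms t.
Proof. exact: codom_f. Qed.

Lemma weight_moments t k : admissible t -> weight t (@moments R t k) = prop k.
Proof.
move=> [_ _ _ inj]; rewrite /weight (big_pred1 k) // => j.
by apply/eqP/eqP => [/inj|->].
Qed.

Lemma weight_out t x : x \notin atoms t -> weight t x = 0.
Proof.
move=> xt; rewrite /weight big_pred0 // => k.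
by apply: contraNF xt => /eqP <-; exact: mem_atoms.
Qed.

Lemma weight_gt0 t x : admissible t -> x \in atoms t -> 0 < weight t x.
Proof.
by move=> at_ /codomP[k ->]; rewrite weight_moments //; case: at_.
Qed.

(** After exchanging the sums, each component meets exactly one member of [L]. The list may exceed
    the atoms, so that two mixtures can share it. *)
Lemma sum_weight (L : seq (R * R)) (f : R * R -> R) t :
  uniq L -> {subset atoms t <= L} ->
  \sum_(x <- L) weight t x * f x = \sum_(k < ncomp t) prop k * f (moments k).
Proof.
move=> uL tL; under eq_bigr => x _ do rewrite mulr_suml big_mkcond /=.
rewrite exchange_big /=; apply: eq_bigr => k _.
rewrite (bigD1_seq (moments k)) //=; last exact/tL/mem_atoms.
by rewrite eqxx big1 ?addr0 // => x; rewrite eq_sym => /negbTE ->.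
Qed.

Lemma sum_weight1 (L : seq (R * R)) t : admissible t ->
  uniq L -> {subset atoms t <= L} -> \sum_(x <- L) weight t x = 1.
Proof.
move=> [_ _ p1 _] uL tL.
have := sum_weight (fun=> 1) uL tL.
by under eq_bigr do rewrite mulr1; under [in RHS]eq_bigr do rewrite mulr1;
  rewrite p1.
Qed.

Lemma densityE (L : seq (R * R)) t y : admissible t ->
  uniq L -> {subset atoms t <= L} ->
  density t y = \sum_(x <- L) weight t x * atom_coef x * gexp (atom_exp x) y.
Proof.
move=> [_ v0 _ _] uL tL; under eq_bigr do rewrite -mulrA.
rewrite sum_weight //; apply: eq_bigr => k _.
by rewrite -normal_pdf_gexp ?mulrA //; exact: v0.
Qed.

Lemma ncomp_gt0 t : admissible t -> (0 < ncomp t)%N.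
Proof.
move=> [_ _ + _]; case: (ncomp t) (@prop R t) => // p.
by rewrite big_ord0 => /eqP; rewrite eq_sym oner_eq0.
Qed.

Lemma density_gt0 t y : admissible t -> 0 < density t y.
Proof.
move=> at_; have [p0 v0 _ _] := at_.
have pos k : 0 < prop k / sd k * normal_pdf 0 1 ((y - mean k) / @sd R t k).
  rewrite -mulrA mulr_gt0 // (normal_pdf_gexp (x := moments k)) ?v0 //.
  by rewrite mulr_gt0 ?gexp_gt0 ?atom_coef_gt0 //; exact: v0.
rewrite /density (bigD1 (Ordinal (ncomp_gt0 at_))) //=.
by rewrite ltr_pwDl // sumr_ge0 // => k _; exact: ltW.
Qed.

(** The atoms are exactly the points of positive weight, so both atom lists are permutations of each
    other; the weight at an atom returns its proportion. *)
Lemma same_weight s t : admissible s -> admissible t ->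
  weight s =1 weight t -> ncomp s = ncomp t /\ components s = components t.
Proof.
move=> as_ at_ st; split.
  suff /perm_size : perm_eq (atoms s) (atoms t).
    by rewrite /atoms !size_codom !card_ord.
  apply: uniq_perm; rewrite ?atoms_uniq // => x.
  apply/idP/idP; apply: contraTT => /weight_out w0; apply/negP.
    by move/(weight_gt0 as_); rewrite st w0 ltxx.
  by move/(weight_gt0 at_); rewrite -st w0 ltxx.
suff sub s' t' : admissible s' -> admissible t' -> weight s' =1 weight t' ->
    components s' `<=` components t'.
  by apply/seteqP; split; apply: sub => // x; rewrite st.
move=> as' at' st' _ [k _ <-].
have : moments k \in atoms t'.
  apply: contraT => /weight_out; rewrite -st' weight_moments // => p0.
  by have [/(_ k)] := as'; rewrite p0 ltxx.
case/codomP => j kj; exists j => //.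
have [-> ->] := kj.
by rewrite -(weight_moments j at') -kj -st' weight_moments.
Qed.

Lemma admissible_mirror t : admissible t -> admissible (mirror t).
Proof.
move=> [p0 v0 p1 inj]; split => // j k [/oppr_inj mjk vjk].
by apply: inj => /=; rewrite mjk vjk.
Qed.

Lemma density_mirror t y : density (mirror t) y = density t (- y).
Proof.
have oddE (m d : R) : (y - - m) / d = - ((- y - m) / d).
  by rewrite -mulNr; congr (_ / _); ring.
apply: eq_bigr => k _ /=; rewrite [X in normal_pdf _ _ X]oddE.
by rewrite !normal_pdf01E sqrrN.
Qed.

Lemma same_params_mirror s t :
  same_params (mirror s) (mirror t) -> same_params s t.
Proof.
move=> [/= nn cc aa /oppr_inj bb]; split=> //.
have im u : components u =
    (fun z => (z.1.1, - z.1.2, z.2)) @` components (mirror u).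
  rewrite /components image_comp; apply: eq_imagel => k _ /=; rewrite opprK //.
by rewrite im cc -im.
Qed.

(** All coefficients are positive, so every atom competes for the lead; the winner has the largest
    quadratic coefficient, that is, the largest variance. *)
Lemma density_lead t : admissible t -> exists x (c : R),
  [/\ 0 < c, x \in atoms t,
      forall z, z \in atoms t -> (atom_exp z).1 <= (atom_exp x).1 &
      density t y / gexp (atom_exp x) y @[y --> +oo] --> c].
Proof.
move=> at_; have uL := atoms_uniq at_.
have ueL : uniq (map (@atom_exp R) (atoms t)).
  by rewrite map_inj_in_uniq //; apply: atom_exp_inj => x; exact: atoms_var_gt0.
have c0 x : x \in atoms t -> 0 < weight t x * atom_coef x.
  move=> xt; rewrite mulr_gt0 ?weight_gt0 // atom_coef_gt0 //.
  exact: atoms_var_gt0 xt.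
have [c_0|[x xt [_ xmax xlim]]] :=
  lead_dichotomy (fun x => weight t x * atom_coef x) ueL.
  have m0 := mem_atoms (Ordinal (ncomp_gt0 at_)).
  by have := c0 _ m0; rewrite c_0 ?ltxx.
exists x, (weight t x * atom_coef x); split=> //; first exact: c0.
  move=> z zt; have /orP[/eqP->//|] := xmax z zt (lt0r_neq0 (c0 _ zt)).
  by rewrite /lexlt => /orP[/ltW//|/andP[/eqP->]].
by under eq_fun do rewrite (densityE _ at_ uL) //.
Qed.

(* The quadratic coefficient [p] is -1/(2 v) for the largest variance v, hence
   the same at both ends of the line. *)
Lemma density_lead2 t : admissible t -> exists p q q' c c' : R,
  [/\ 0 < c, 0 < c', density t y / gexp (p, q) y @[y --> +oo] --> c &
      density t (- y) / gexp (p, q') y @[y --> +oo] --> c'].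
Proof.
move=> at_; have [x [c [c0 xt xmax xlim]]] := density_lead at_.
have [x' [c' [c'0 x't x'max x'lim]]] := density_lead (admissible_mirror at_).
have pp : (atom_exp x).1 = (atom_exp x').1.
  apply/eqP; rewrite eq_le; apply/andP; split.
    have /codomP[k ->] := xt; exact: x'max (mem_atoms (t := mirror t) k).
  have /codomP[k ->] := x't; exact: xmax (mem_atoms (t := t) k).
exists (atom_exp x).1, (atom_exp x).2, (atom_exp x').2, c, c'.
split=> //; rewrite pp.
by move: x'lim; under eq_fun do rewrite density_mirror.
Qed.

End Mixtures.

(** * Linear combinations of two mixture densities *)

Section MixtureDifference.
Variable R : realType.
Implicit Types (s t : params R) (u v : R).

Lemma common_atoms s t : admissible s -> admissible t ->
  exists L : seq (R * R), [/\ uniq L, {subset atoms s <= L},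
    {subset atoms t <= L}, uniq (map (@atom_exp R) L) &
    forall x, x \in L -> 0 < x.2].
Proof.
move=> as_ at_; exists (undup (atoms s ++ atoms t)).
have pos x : x \in undup (atoms s ++ atoms t) -> 0 < x.2.
  by rewrite mem_undup mem_cat => /orP[]; exact: atoms_var_gt0.
split=> //; first exact: undup_uniq.
- by move=> x xs; rewrite mem_undup mem_cat xs.
- by move=> x xt; rewrite mem_undup mem_cat xt orbT.
- by rewrite map_inj_in_uniq ?undup_uniq //; exact: atom_exp_inj.
Qed.

(** Over a common list of atoms the combination is a single sum with distinct exponents. The factors
    [u], [v] will be constant values of F when the slopes vanish, and 1 otherwise. *)
Lemma lincomb_density_lead s t u v : admissible s -> admissible t ->
  (forall x, u * weight s x = v * weight t x) \/
  exists e (c : R), c != 0 /\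
    (u * density s y - v * density t y) / gexp e y @[y --> +oo] --> c.
Proof.
move=> as_ at_; have [L [uL sL tL ueL L0]] := common_atoms as_ at_.
pose c x := (u * weight s x - v * weight t x) * atom_coef x.
have [c0|[x xL [cx0 _ lim]]] := lead_dichotomy c ueL.
  left=> x; have [xL|xL] := boolP (x \in L).
    have /eqP := c0 x xL; rewrite mulf_eq0 subr_eq0 => /orP[/eqP//|].
    by rewrite gt_eqF // atom_coef_gt0 // L0.
  by rewrite [weight s x]weight_out ?[weight t x]weight_out ?mulr0 //;
    [exact: contra (@tL x) xL|exact: contra (@sL x) xL].
right; exists (atom_exp x), (c x); split=> //.
rewrite (_ : (fun y => _) =
  fun y => (\sum_(j <- L) c j * gexp (atom_exp j) y) / gexp (atom_exp x) y) //.
apply/funext => y; congr (_ / _).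
rewrite (densityE _ as_ uL sL) (densityE _ at_ uL tL) !mulr_sumr -sumrB.
by apply: eq_bigr => j _; rewrite /c; ring.
Qed.

Lemma weight_of_density s t u v : admissible s -> admissible t ->
  (forall y, u * density s y = v * density t y) ->
  forall x, u * weight s x = v * weight t x.
Proof.
move=> as_ at_ st; have [//|[e [c [c0 lim]]]] := lincomb_density_lead u v as_ at_.
rewrite (_ : (fun _ => _) = fun=> 0) in lim; last first.
  by apply/funext => y; rewrite st subrr mul0r.
move: c0; rewrite -(cvg_unique (@norm_hausdorff _ R) (cvg_cst 0) lim).
by rewrite eqxx.
Qed.

Lemma density_of_weight s t : admissible s -> admissible t ->
  weight s =1 weight t -> density s =1 density t.
Proof.
move=> as_ at_ st y; have [L [uL sL tL _ _]] := common_atoms as_ at_.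
rewrite (densityE _ as_ uL sL) (densityE _ at_ uL tL).
by apply: eq_bigr => x _; rewrite st.
Qed.

Lemma proportional_weight s t u v : admissible s -> admissible t ->
  (forall x, u * weight s x = v * weight t x) -> u = v.
Proof.
move=> as_ at_ st; have [L [uL sL tL _ _]] := common_atoms as_ at_.
rewrite -[LHS]mulr1 -(sum_weight1 as_ uL sL).
rewrite -[RHS]mulr1 -(sum_weight1 at_ uL tL) !mulr_sumr.
exact: eq_bigr.
Qed.

End MixtureDifference.

(** * Tails under affine maps, and condition (B) *)

Section Tails.
Variable R : realType.
Implicit Types (x : R * R) (H : R -> R) (m r p q a b c C y z : R).

(** The exponent at y minus the exponent at m + r y is P y^2 + Q y + S. It tends to +oo, or is a
    positive constant if p = 0 and r = 1; a lower bound e > 0 gives the factor exp (-e). *)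
Lemma gexp_affine_contraction x m r : lexlt x 0 -> lexlt (1, 0) (r, m) ->
  exists2 rho, 0 <= rho < 1 &
    \forall y \near +oo, gexp x (m + r * y) <= rho * gexp x y.
Proof.
case: x => p q x0 rm.
pose P := - (p * (r ^+ 2 - 1)); pose Q := - (2 * p * r * m + q * (r - 1)).
pose S := - (p * m ^+ 2 + q * m).
suff [e e0 near_e] : exists2 e, 0 < e &
    \forall y \near +oo, e <= P * y ^+ 2 + Q * y + S.
  exists (expR (- e)); first by rewrite expR_ge0 /= expR_lt1 oppr_lt0.
  apply: filterS near_e => y; rewrite /gexp -expRD ler_expR /= /P /Q /S; lra.
have far : lexlt (- (P, Q)) 0 -> exists2 e, 0 < e &
    \forall y \near +oo, e <= P * y ^+ 2 + Q * y + S.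
  by move=> PQ; exists 1 => //; apply: cvgry_ge; exact: quadratic_cvgy.
move: x0 rm far; rewrite /lexlt /= !oppr_lt0 !oppr_eq0 /P /Q /S.
move=> /orP[p0|/andP[/eqP-> q0]] /orP[r1|/andP[/eqP<- m0]] far.
- apply: far; apply/orP; left; rewrite oppr_gt0 nmulr_rlt0 //.
  by nra.
- by apply: far; apply/orP; right; apply/andP; split; [apply/eqP; ring|nra].
- by apply: far; apply/orP; right; apply/andP; split; [apply/eqP; ring|nra].
- exists (- (q * m)); first by nra.
  by near=> y; lra.
Unshelve. all: by end_near. Qed.

(* Iterating [y |-> m + r * y] sends every large [y] to infinity, where
   [H - M * gexp x] vanishes, while this difference does not decrease. *)
Lemma tail_upper_bound H x m r C : lexlt x 0 -> lexlt (1, 0) (r, m) -> 0 < C ->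
  H y @[y --> +oo] --> 0 ->
  (\forall y \near +oo, H y - H (m + r * y) <= C * gexp x y) ->
  exists M, \forall y \near +oo, H y <= M * gexp x y.
Proof.
move=> x0 rm C0 H0 dH.
have [rho /andP[rho0 rho1] contr] := gexp_affine_contraction x0 rm.
(* A uniform step length, which makes the orbit unbounded. *)
have [e e0 incr] : exists2 e, 0 < e & \forall y \near +oo, y + e <= m + r * y.
  move: rm; rewrite /lexlt /= => /orP[r1|/andP[/eqP<- m0]].
    exists 1 => //; near=> y.
    suff : (1 - m) / (r - 1) <= y by rewrite ler_pdivrMr ?subr_gt0 //; lra.
    by near: y; apply: nbhs_pinfty_ge; rewrite num_real.
  by exists m => //; near=> y; lra.
(* This M makes C gexp x y at most M (gexp x y - gexp x (m + r y)), so that [K] below does not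
   decrease along the orbit. *)
have [M M0 CM] : exists2 M, 0 < M & C = M * (1 - rho).
  exists (C / (1 - rho)); first by rewrite divr_gt0 // subr_gt0.
  by rewrite divfK // gt_eqF // subr_gt0.
exists M.
pose K y := H y - M * gexp x y.
have K0 : K y @[y --> +oo] --> 0.
  rewrite -(subr0 0) -[X in _ - X](mulr0 M).
  by apply: cvgB => //; apply: cvgM; [exact: cvg_cst|exact: gexp_cvg0].
have [Y [_ HY]] : \forall y \near +oo, y + e <= m + r * y /\ K y <= K (m + r * y).
  near=> y; split; first by near: y.
  have d : H y - H (m + r * y) <= C * gexp x y by near: y.
  have g : gexp x (m + r * y) <= rho * gexp x y by near: y.
  have : M * gexp x (m + r * y) <= M * (rho * gexp x y) by rewrite ler_pM2l.
  by rewrite /K; move: d; rewrite CM; lra.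
exists Y; split; first by rewrite num_real.
move=> y Yy; rewrite -subr_le0 -/(K y) leNgt; apply/negP => Ky.
have iterK n : y + e *+ n <= iter n (fun w => m + r * w) y /\
               K y <= K (iter n (fun w => m + r * w) y).
  elim: n => [|n [IHy IHK]] /=; first by rewrite mulr0n addr0.
  have [|? ?] := HY (iter n (fun w => m + r * w) y).
    by apply: lt_le_trans IHy; rewrite ltr_wpDr // mulrn_wge0 // ltW.
  rewrite mulrSr; lra.
have [Z [_ HZ]] := cvgr_lt _ K0 _ Ky.
(* Enough steps to pass Z, beyond which K is smaller than its value at y. *)
have [] := iterK (Num.bound `|(Z - y) / e|).
set n := Num.bound _ => yn; rewrite leNgt => /negP; apply; apply: HZ.
apply: lt_le_trans yn; rewrite -ltrBlDl -mulr_natl -ltr_pdivrMr //.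
exact: le_lt_trans (ler_norm _) (archi_boundP (normr_ge0 _)).
Unshelve. all: by end_near. Qed.

Lemma bounded_away_cvg_false (f : R -> R) c C : 0 < c ->
  (\forall z \near +oo, c <= `|f z| <= C) ->
  ~ (f z @[z --> +oo] --> 0 \/ `|f z| @[z --> +oo] --> +oo).
Proof.
move=> c0 fcC [f0|fy].
  have fc : \forall z \near +oo, `|f z| < c by exact: cvgr0_norm_lt.
  near (pinfty_nbhs R) => z.
  have : c <= `|f z| <= C by near: z.
  have : `|f z| < c by near: z.
  by move=> ? /andP[]; lra.
have fC : \forall z \near +oo, C < `|f z| by exact: cvgry_gt.
near (pinfty_nbhs R) => z.
have : c <= `|f z| <= C by near: z.
have : C < `|f z| by near: z.
by move=> ? /andP[]; lra.
Unshelve. all: by end_near. Qed.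

(* Compare [F z] with [F] at [a + b * y], where [y = z / (2 * b) + y0] and
   [y0] is the critical point of [p * y ^+ 2 + q * y] (and [0] if [p = 0]):
   the tail of the latter dominates, and its exponent in [z] has no positive
   linear term, as [right_tail_condition] demands. *)
Lemma right_tail_not_gexp (F : R -> R) a b p q c C :
  right_tail_condition F -> (forall z, F z <= 1) ->
  0 < b -> 0 < c -> lexlt (p, q) 0 ->
  (\forall y \near +oo,
     c * gexp (p, q) y <= 1 - F (a + b * y) <= C * gexp (p, q) y) -> False.
Proof.
move=> condB F1 b0 c0 pq tail.
(* [l] is the derivative of the exponent at [y0]. It is 0 if p < 0; if p = 0, division by zero
   yields [y0] = 0, so l = q < 0. *)
pose y0 := - (q / (2 * p)); pose l := 2 * p * y0 + q.
have bn : b != 0 by rewrite gt_eqF.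
have [p0 [l0 [pl l3]]] : p <= 0 /\ l <= 0 /\ p + l != 0 /\
    (p < 0 \/ p = 0 /\ q < 0 /\ y0 = 0).
  move: pq; rewrite /lexlt /= /l /y0 => /orP[p0|/andP[/eqP-> q0]].
    have pn : p != 0 by rewrite lt_eqF.
    have -> : 2 * p * - (q / (2 * p)) + q = 0 by field.
    by rewrite ltW // lexx addr0; split=> //; split=> //; split=> //; left.
  rewrite !(mulr0, invr0, oppr0, mul0r, add0r) lexx (ltW q0) lt_eqF //.
  by split=> //; split=> //; split=> //; right.
(* At y0 + z / (2 b) the exponent is a constant plus - d1 z^2 - d2 z; the constant goes into [k]. *)
pose d1 := - (p / (4 * b ^+ 2)); pose d2 := - (l / (2 * b)).
have b2 : 0 < 4 * b ^+ 2 by rewrite mulr_gt0 // exprn_gt0.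
have bb : 0 < 2 * b by rewrite mulr_gt0.
have d10 : 0 <= d1 by rewrite oppr_ge0 pmulr_lle0 // invr_gt0.
have d20 : 0 <= d2 by rewrite oppr_ge0 pmulr_lle0 // invr_gt0.
have d12 : d1 + d2 != 0.
  rewrite paddr_eq0 // !oppr_eq0 !mulf_eq0 !invr_eq0 !(gt_eqF b2) !(gt_eqF bb).
  rewrite !orbF; apply: contra pl => /andP[/eqP-> /eqP->].
  by rewrite addr0.
have := condB (a + b * y0) 2^-1 d1 d2 _ d10 d20 d12.
rewrite invr_gt0 => /(_ (ltr0n _ 2)).
pose k := expR (p * y0 ^+ 2 + q * y0).
apply: (@bounded_away_cvg_false _ (c / 2 * k) (C * k)).
  by rewrite mulr_gt0 ?expR_gt0 // divr_gt0.
have ynear : \forall z \near +oo, c * gexp (p, q) (y0 + (2 * b)^-1 * z) <=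
    1 - F (a + b * (y0 + (2 * b)^-1 * z)) <=
    C * gexp (p, q) (y0 + (2 * b)^-1 * z).
  have bbV : 0 < (2 * b)^-1 by rewrite invr_gt0.
  exact: (@affine_cvgy _ y0 _ bbV _ tail).
have znear : \forall z \near +oo, c * gexp (p, q) (- (a / b) + b^-1 * z) <=
    1 - F (a + b * (- (a / b) + b^-1 * z)) <=
    C * gexp (p, q) (- (a / b) + b^-1 * z).
  have bV : 0 < b^-1 by rewrite invr_gt0.
  exact: (@affine_cvgy _ (- (a / b)) _ bV _ tail).
(* Passing from y0 + z / (2 b) to (z - a) / b multiplies the quadratic coefficient in z by 4 or, if
   p = 0, the negative linear one by 2; hence g tends to 0. *)
pose g z := gexp (p, q) (- (a / b) + b^-1 * z) /
            gexp (p, q) (y0 + (2 * b)^-1 * z).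
have g0 : C * g z @[z --> +oo] --> C * 0.
  apply: cvgM; first exact: cvg_cst.
  pose P := - (p * (3 / (4 * b ^+ 2))).
  pose Q := 2 * p * a / b ^+ 2 + p * y0 / b - q / (2 * b).
  pose S := - (p * a ^+ 2 / b ^+ 2 - q * a / b) + (p * y0 ^+ 2 + q * y0).
  rewrite (_ : g = (fun u => expR (- u)) \o (fun z => P * z ^+ 2 + Q * z + S)).
    apply: (cvg_comp _ _ _ (@cvgr_expR R)); apply: quadratic_cvgy.
    rewrite /lexlt /= !oppr_lt0 oppr_eq0 /P /Q.
    case: l3 => [pl0|[-> [q0 ->]]].
      apply/orP; left; rewrite oppr_gt0 nmulr_rlt0 // divr_gt0 //.
    apply/orP; right; rewrite !(mul0r, mulr0, add0r) oppr0 eqxx /=.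
    by rewrite oppr_gt0 pmulr_llt0 // invr_gt0.
  apply/funext => z; rewrite /g /gexp -expRN -expRD /=; congr expR.
  by rewrite /P /Q /S; field.
have gnear : \forall z \near +oo, C * g z < c / 2.
  by apply: cvgr_lt g0 _ _; rewrite mulr0 divr_gt0.
near=> z.
have : c * gexp (p, q) (y0 + (2 * b)^-1 * z) <=
    1 - F (a + b * (y0 + (2 * b)^-1 * z)) <=
    C * gexp (p, q) (y0 + (2 * b)^-1 * z).
  by near: z.
have : c * gexp (p, q) (- (a / b) + b^-1 * z) <=
    1 - F (a + b * (- (a / b) + b^-1 * z)) <=
    C * gexp (p, q) (- (a / b) + b^-1 * z) by near: z.
have : C * g z < c / 2 by near: z.
rewrite /g mulrA ltr_pdivrMr ?gexp_gt0 //.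
have -> : a + b * (- (a / b) + b^-1 * z) = z by field.
have -> : a + b * (y0 + (2 * b)^-1 * z) = a + b * y0 + 2^-1 * z by field.
set E := expR (- d1 * z ^+ 2 - d2 * z).
have E0 : 0 < E by exact: expR_gt0.
have -> : gexp (p, q) (y0 + (2 * b)^-1 * z) = k * E.
  rewrite /gexp -expRD; congr expR; rewrite /d1 /d2 /l /=.
  by field.
move=> h1 /andP[_ h2] /andP[h3 h4].
have k0 : 0 < k by exact: expR_gt0.
have F_z : 0 <= 1 - F z by rewrite subr_ge0.
rewrite normrM normfV [`|E|]gtr0_norm // ler_pdivlMr // ler_pdivrMr //.
(* The difference is (1 - F z) minus the tail at a + b y0 + z / 2. The first is below c k E / 2, the
   second between c k E and C k E. *)
rewrite ler0_norm; last by nra.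
by apply/andP; split; nra.
Unshelve. all: by end_near. Qed.

End Tails.

(** * Comparison of two parameters according to their slopes *)

Section Identification.
Variables (R : realType) (F : cumulativeBounded (0 : R) (1 : R)).
Hypothesis F_strict : {homo F : x y / x < y}.
Implicit Types (s t : params R) (a b y : R).

Let F_inj : injective F.
Proof. by apply: inc_inj; exact: le_mono. Qed.

Lemma cdf_gt0 y : 0 < F y.
Proof.
rewrite ltNge; apply/negP => Fy0.
have F1 : F (y - 1) < 0 by apply: lt_le_trans Fy0; apply: F_strict; lra.
have near_y : \forall z \near -oo, F (y - 1) < F z.
  exact: cvgr_gt (cumulativeNy F) _ F1.
near (ninfty_nbhs R) => z.
have : F (y - 1) < F z by near: z.
rewrite ltNge => /negP; apply; apply/ltW/F_strict.
by near: z; apply: nbhs_ninfty_lt; rewrite num_real.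
Unshelve. all: by end_near. Qed.

Lemma cdf_lt1 y : F y < 1.
Proof.
rewrite ltNge; apply/negP => Fy1.
have F1 : 1 < F (y + 1) by apply: le_lt_trans Fy1 _; apply: F_strict; lra.
have near_y : \forall z \near +oo, F z < F (y + 1).
  exact: cvgr_lt (cumulativey F) _ F1.
near (pinfty_nbhs R) => z.
have : F z < F (y + 1) by near: z.
rewrite ltNge => /negP; apply; apply/ltW/F_strict.
by near: z; apply: nbhs_pinfty_gt; rewrite num_real.
Unshelve. all: by end_near. Qed.

Lemma cdf_affine_cvg1 a b : 0 < b -> F (a + b * y) @[y --> +oo] --> (1 : R).
Proof.
by move=> b0; apply: (cvg_comp _ _ (affine_cvgy a b0)); exact: cumulativey.
Qed.

Lemma cdf_affine_cvg0 a b : b < 0 -> F (a + b * y) @[y --> +oo] --> (0 : R).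
Proof.
by move=> b0; apply: (cvg_comp _ _ (affine_cvgNy a b0)); exact: cumulativeNy.
Qed.

(** At +oo the vanishing of Ft gives (p, q) < (P, Q). At -oo, where Ft tends to 1, density t is at
    most twice density s, which excludes p < P. So p = P and q < Q, and Ft decays like exp ((q - Q)
    y), against (A). *)
Lemma opposite_slopes_false s t : left_tail_condition F ->
  admissible s -> admissible t -> observed F s =1 observed F t ->
  0 <= slope s -> slope t < 0 -> False.
Proof.
move=> condA as_ at_ st bs bt.
have [p [q [q' [c [c' [c0 c'0 slim slim']]]]]] := density_lead2 as_.
have [P [Q [Q' [C [C' [C0 C'0 tlim tlim']]]]]] := density_lead2 at_.
set Fs := fun y => F (intercept s + slope s * y).
set Ft := fun y => F (intercept t + slope t * y).
have eqst y : density s y * Fs y = density t y * Ft y by rewrite -!observedE.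
have [l l0 Fslim] : exists2 l : R, 0 < l & Fs y @[y --> +oo] --> l.
  move: bs; rewrite le0r => /orP[/eqP b0|b0]; last first.
    by exists 1 => //; exact: cdf_affine_cvg1.
  exists (F (intercept s)); first exact: cdf_gt0.
  rewrite (_ : (fun _ => _) = fun=> F (intercept s)); first exact: cvg_cst.
  by apply/funext => y; rewrite /Fs b0 mul0r addr0.
have Ftlim : Ft y @[y --> +oo] --> (0 : R) by exact: cdf_affine_cvg0.
have Fs_neq0 y : Fs y != 0 by rewrite gt_eqF // cdf_gt0.
have dt_neq0 y : density t y != 0 by rewrite gt_eqF // density_gt0.
have ratio y : density s y / density t y = Ft y / Fs y.
  by apply/eqP; rewrite eqr_div // eqst mulrC.
have lt1 : lexlt (p, q) (P, Q).
  apply: lexlt_of_ratio_cvg0 slim tlim _; [|exact: lt0r_neq0|].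
    by move=> y; exact: density_gt0.
  under eq_fun do rewrite ratio.
  by rewrite -(mul0r l^-1); apply: cvgM => //; apply: cvgV => //; exact: lt0r_neq0.
have : ~~ lexlt (p, q') (P, Q').
  have tlim2 : 2^-1 * density t (- y) / gexp (P, Q') y @[y --> +oo] --> 2^-1 * C'.
    under eq_fun do rewrite -mulrA.
    by apply: cvgM => //; exact: cvg_cst.
  apply: nlexlt_of_le tlim2 slim'; first by rewrite mulr_gt0 ?invr_gt0.
  have half : \forall y \near +oo, 2^-1 < Ft (- y).
    have h1 : F (intercept t + (- slope t) * y) @[y --> +oo] --> (1 : R).
      by apply: cdf_affine_cvg1; rewrite oppr_gt0.
    have h2 : 2^-1 < 1 :> R by rewrite invf_lt1 ?ltr1n.
    have h3 := cvgr_gt _ h1 _ h2.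
    by near=> y; rewrite /Ft mulrN -mulNr; near: y; exact: h3.
  near=> y.
  have : 2^-1 < Ft (- y) by near: y.
  have := eqst (- y); have : Fs (- y) < 1 by exact: cdf_lt1.
  have := density_gt0 (- y) as_; have := density_gt0 (- y) at_.
  by nra.
move: lt1; rewrite /lexlt /= => /orP[->//|/andP[/eqP pP qQ] _].
have Flim : Ft y / gexp (0, q - Q) y @[y --> +oo] --> l * (c / C).
  rewrite (_ : (fun _ => _) = (fun y => Fs y *
    ((density s y / gexp (p, q) y) / (density t y / gexp (P, Q) y)))).
    by apply: cvgM => //; apply: cvgM => //; apply: cvgV => //; exact: lt0r_neq0.
  apply/funext => y; rewrite (_ : (0, q - Q) = (p, q) - (P, Q)); last first.
    by congr pair => /=; rewrite pP subrr.
  have -> : Ft y = density s y * Fs y / density t y.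
    by rewrite eqst mulrC mulKf // gt_eqF // density_gt0.
  rewrite gexpB; field.
  by rewrite !gt_eqF ?gexp_gt0 ?density_gt0.
(* With z = intercept t + slope t * y, d z is (q - Q) y plus a constant; d > 0 as a quotient of two
   negative numbers. *)
pose d := (q - Q) / slope t.
have d0 : 0 < d by rewrite nmulr_rgt0 ?invr_lt0 // subr_lt0.
have zlim := affine_cvgNy (intercept t) bt.
pose k := expR (- (d * intercept t)).
have qlim : Ft y / expR (d * (intercept t + slope t * y)) @[y --> +oo] -->
    l * (c / C) * k.
  rewrite (_ : (fun _ => _) = (fun y => Ft y / gexp (0, q - Q) y * k)).
    by apply: cvgM => //; exact: cvg_cst.
  apply/funext => y; rewrite -mulrA; congr (_ * _).
  rewrite /gexp /k /d -!expRN -expRD; congr expR => /=; field.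
  by rewrite lt_eqF.
have L0 : 0 < l * (c / C) * k by rewrite !mulr_gt0 ?invr_gt0 ?expR_gt0.
have [F0|Fy] := condA d d0.
  have h := cvg_comp _ _ zlim F0.
  by move: L0; rewrite (cvg_unique (@norm_hausdorff _ R) qlim h) ltxx.
have h := cvg_comp _ _ zlim Fy.
have g1 : \forall y \near +oo, l * (c / C) * k + 1 <
  Ft y / expR (d * (intercept t + slope t * y)) by exact: cvgry_gt h _.
have g2 : \forall y \near +oo, Ft y / expR (d * (intercept t + slope t * y)) <
  l * (c / C) * k + 1 by apply: cvgr_lt qlim _ _; rewrite ltrDl.
near (pinfty_nbhs R) => y.
have h1 : l * (c / C) * k + 1 <
  Ft y / expR (d * (intercept t + slope t * y)) by near: y.
have : Ft y / expR (d * (intercept t + slope t * y)) <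
  l * (c / C) * k + 1 by near: y.
by move/(lt_trans h1); rewrite ltxx.
Unshelve. all: by end_near. Qed.

(** Equal densities would force equal arguments of F. Otherwise Ft - Fs is asymptotic to a multiple
    of a decaying [gexp]; with Ft = Fs o T, T y = m + r y, this bounds the tail 1 - Fs from both
    sides. *)
Lemma expanding_slopes_false s t : right_tail_condition F ->
  admissible s -> admissible t -> observed F s =1 observed F t ->
  0 < slope s -> lexlt (slope s, intercept s) (slope t, intercept t) -> False.
Proof.
move=> condB as_ at_ st bs lt_st.
have bt : 0 < slope t.
  by move: lt_st; rewrite /lexlt /= => /orP[/(lt_trans bs)//|/andP[/eqP<-]].
set Fs := fun y => F (intercept s + slope s * y).
set Ft := fun y => F (intercept t + slope t * y).
have eqst y : density s y * Fs y = density t y * Ft y by rewrite -!observedE.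
have Fs1 : Fs y @[y --> +oo] --> (1 : R) by exact: cdf_affine_cvg1.
have Ft1 : Ft y @[y --> +oo] --> (1 : R) by exact: cdf_affine_cvg1.
have Fs_neq0 y : Fs y != 0 by rewrite gt_eqF // cdf_gt0.
have dt_neq0 y : density t y != 0 by rewrite gt_eqF // density_gt0.
have [wst|[e [c [c0 lim]]]] := lincomb_density_lead 1 1 as_ at_.
  have dst : density s =1 density t.
    by apply: density_of_weight => // x; have := wst x; rewrite !mul1r.
  have Fst y : intercept s + slope s * y = intercept t + slope t * y.
    by apply: F_inj; apply: (mulfI (dt_neq0 y)); rewrite -eqst dst.
  have := Fst 0; have := Fst 1; rewrite !mulr0 !mulr1 !addr0 => b_eq a_eq.
  by move: b_eq lt_st; rewrite a_eq => /addrI ->; rewrite /lexlt /= !ltxx andbF.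
have {}lim : (density s y - density t y) / gexp e y @[y --> +oo] --> c.
  by move: lim; under eq_fun do rewrite !mul1r.
have [x [C [C0 _ _ tlim]]] := density_lead at_.
have ratio y : (density s y - density t y) / density t y =
               (Ft y - Fs y) / Fs y.
  apply/eqP; rewrite eqr_div // !mulrBl eqst; apply/eqP; ring.
(* Both F factors tend to 1, so by [ratio] the density difference is negligible against density
   t. *)
have ex : lexlt (e - atom_exp x) 0.
  rewrite -lexlt_sub; apply: lexlt_of_ratio_cvg0 c0 lim tlim _.
    by move=> y; exact: density_gt0.
  under eq_fun do rewrite ratio.
  rewrite -(mul0r 1^-1) -(subrr 1); apply: cvgM; first exact: cvgB.
  by apply: cvgV => //; exact: oner_neq0.
have {ratio}Dlim :
    (Ft y - Fs y) / gexp (e - atom_exp x) y @[y --> +oo] --> c / C.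
  rewrite -(mul1r (c / C)) (_ : (fun _ => _) = (fun y => Fs y *
    (((density s y - density t y) / gexp e y) /
     (density t y / gexp (atom_exp x) y)))).
    by apply: cvgM => //; apply: cvgM => //; apply: cvgV => //; exact: lt0r_neq0.
  apply/funext => y; rewrite -[Ft y - Fs y](divfK (Fs_neq0 y)) -ratio gexpB.
  field.
  by rewrite dt_neq0 !gt_eqF ?gexp_gt0.
pose m := (intercept t - intercept s) / slope s.
pose r := slope t / slope s.
have bn : slope s != 0 by rewrite gt_eqF.
have FsE y : Fs (m + r * y) = Ft y.
  by rewrite /Fs /Ft /m /r; congr (F _); field.
have rm : lexlt (1, 0) (r, m).
  rewrite /lexlt /= /r /m ltr_pdivlMr // mul1r pmulr_lgt0 ?invr_gt0 // subr_gt0.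
  move: lt_st; rewrite /lexlt /= => /orP[->//|/andP[/eqP<- ->]].
  by rewrite divff // eqxx orbT.
have ge_near : \forall y \near +oo, 0 <= (Ft y - Fs y) / gexp (e - atom_exp x) y.
  have : \forall y \near +oo, y <= m + r * y.
    move: (rm); rewrite /lexlt /= => /orP[r1|/andP[/eqP<- m0]]; last first.
      by near=> y; lra.
    near=> y; suff : - m / (r - 1) <= y by rewrite ler_pdivrMr ?subr_gt0 //; lra.
    by near: y; apply: nbhs_pinfty_ge; rewrite num_real.
  apply: filterS => y ym; rewrite divr_ge0 ?(ltW (gexp_gt0 _ _)) // subr_ge0.
  rewrite -FsE; apply: (ltW_homo F_strict).
  by rewrite lerD2l ler_pM2l.
(* So far c is only nonzero; its sign comes from Ft >= Fs near +oo. *)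
have A0 : 0 < c / C.
  rewrite lt_neqAle eq_sym mulf_neq0 ?invr_neq0 ?(lt0r_neq0 C0) //=.
  exact: (ler_cvg_to (cvg_cst 0) Dlim ge_near).
have near_lo : \forall y \near +oo,
    c / C / 2 < (Ft y - Fs y) / gexp (e - atom_exp x) y.
  by apply: cvgr_gt Dlim _ _; lra.
have near_hi : \forall y \near +oo,
    (Ft y - Fs y) / gexp (e - atom_exp x) y < c / C * 2.
  by apply: cvgr_lt Dlim _ _; lra.
have ex' : lexlt ((e - atom_exp x).1, (e - atom_exp x).2) 0 by [].
have [| | |M near_M] :=
  @tail_upper_bound _ (fun y => 1 - Fs y) _ m r (c / C * 2) ex rm.
- by rewrite mulr_gt0.
- by rewrite -(subrr 1); apply: cvgB => //; exact: cvg_cst.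
- apply: filterS near_hi => y; rewrite ltr_pdivrMr ?gexp_gt0 // FsE; lra.
apply: (@right_tail_not_gexp _ F (intercept s) (slope s) _ _ (c / C / 2) M
  condB _ bs _ ex').
- by move=> z; exact/ltW/cdf_lt1.
- by rewrite divr_gt0.
(* The lower bound is immediate, since 1 - Fs > Ft - Fs. *)
near=> y; apply/andP; split; last by near: y.
have : c / C / 2 < (Ft y - Fs y) / gexp (e - atom_exp x) y by near: y.
rewrite ltr_pdivlMr ?gexp_gt0 //.
have : Ft y < 1 by exact: cdf_lt1.
rewrite -/(Fs y) /gexp /=; lra.
Unshelve. all: by end_near. Qed.

Lemma positive_slopes_same_params s t : right_tail_condition F ->
  admissible s -> admissible t -> observed F s =1 observed F t ->
  0 < slope s -> 0 < slope t -> same_params s t.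
Proof.
move=> condB as_ at_ st bs bt.
have [st_eq|/lexlt_total/orP[lt_st|lt_ts]] :=
  eqVneq (slope s, intercept s) (slope t, intercept t); last 2 first.
- by case: (expanding_slopes_false condB as_ at_ st bs lt_st).
- by case: (expanding_slopes_false condB at_ as_ (fsym st) bt lt_ts).
have [b_eq a_eq] := st_eq.
have wst x : 1 * weight s x = 1 * weight t x.
  apply: weight_of_density => // y; rewrite !mul1r.
  have Fy : F (intercept t + slope t * y) != 0 by rewrite gt_eqF // cdf_gt0.
  by apply: (mulIf Fy); rewrite -observedE -st observedE a_eq b_eq.
have [] // : ncomp s = ncomp t /\ components s = components t.
by apply: same_weight => // x; have := wst x; rewrite !mul1r.
Qed.

(** Each F factor is a constant. The weights sum to 1 on both sides, so the constants agree, and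
    injectivity of F gives the intercepts. *)
Lemma zero_slopes_same_params s t :
  admissible s -> admissible t -> observed F s =1 observed F t ->
  slope s = 0 -> slope t = 0 -> same_params s t.
Proof.
move=> as_ at_ st bs bt.
have wst x : F (intercept s) * weight s x = F (intercept t) * weight t x.
  apply: weight_of_density => // y; have := st y.
  by rewrite !observedE bs bt !mul0r !addr0 ![F _ * _]mulrC.
have FF := proportional_weight as_ at_ wst.
have [] // : ncomp s = ncomp t /\ components s = components t.
  apply: same_weight => // x; have := wst x; rewrite FF.
  by apply: mulfI; rewrite gt_eqF // cdf_gt0.
by move=> nn cc; split; [| |exact: F_inj|rewrite bs bt].
Qed.

End Identification.

(** * Case analysis on the signs of the two slopes *)

Theorem theorem4 (R : realType) (F : cumulativeBounded (0 : R) (1 : R))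
  (F_strict : {homo F : x y / x < y})
  (F_support : cdf_support F = setT)
  (condA : left_tail_condition F)
  (condB : right_tail_condition F) :
  identifiable F.
Proof.
move=> s t as_ at_ st.
have ams := admissible_mirror as_; have amt := admissible_mirror at_.
have mst : observed F (mirror s) =1 observed F (mirror t).
  move=> y; have := st (- y).
  by rewrite !observedE !density_mirror /= !mulNr !mulrN.
have ts := fsym st; have mts := fsym mst.
(* Two negative slopes are mirrored into two positive ones. A zero slope against a positive one is
   mirrored too, since the opposite-sign argument needs a strictly negative slope. *)
have [bs|bs|bs] := ltrgtP (slope s) 0; have [bt|bt|bt] := ltrgtP (slope t) 0.
- by apply: same_params_mirror; apply: (positive_slopes_same_params F_strict);
    rewrite //= oppr_gt0.
- by case: (opposite_slopes_false F_strict condA at_ as_ ts (ltW bt) bs).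
- by case: (opposite_slopes_false F_strict condA at_ as_ ts _ bs); rewrite bt.
- by case: (opposite_slopes_false F_strict condA as_ at_ st (ltW bs) bt).
- exact: (positive_slopes_same_params F_strict).
- by case: (opposite_slopes_false F_strict condA amt ams mts);
    rewrite /= ?bt ?oppr0 ?oppr_lt0.
- by case: (opposite_slopes_false F_strict condA as_ at_ st _ bt); rewrite bs.
- by case: (opposite_slopes_false F_strict condA ams amt mst);
    rewrite /= ?bs ?oppr0 ?oppr_lt0.
- exact: (zero_slopes_same_params F_strict).
Qed.
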